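(* For fixed $n\ge 1$ and fixed $\omega\in\{+,-\}$, $\operatorname{MEA}_{n,\omega}$ is the unique traversal of $[n]$ satisfying all of the following: (i) the central block $B_0$ is visited first; (ii) every bilateral shell $B_r$ is visited as one contiguous aggregate block; (iii) shell selection obeys maximal normalized radial contrast from the shell most recently engaged, i.e. if the shells are visited in the order $B_{r_0},B_{r_1},\ldots,B_{r_q}$, then for each $1\le k\le q$, $r_k\in\operatorname{arg\,max}_{r\in\{0,\ldots,q\}\setminus\{r_0,\ldots,r_{k-1}\}}|r-r_{k-1}|$; (iv) every two-element block is traversed according to the same global orientation $\omega$, i.e. each two-element $B_r$ is listed in the order $\operatorname{ord}_\omega(B_r)$.
   Context: Let $[n]=\{1,\ldots,n\}$, $a=\lfloor (n+1)/2\rfloor$, $b=\lceil (n+1)/2\rceil$, $q=\lfloor (n-1)/2\rfloor$. For $r\in\{0,\ldots,q\}$ the bilateral shell of normalized radius $r$ is $B_r=\{a-r,b+r\}$ (a singleton exactly when $n$ is odd and $r=0$); the shells partition $[n]$, and $B_0$ is the central block. A traversal of $[n]$ is a sequence listing each element of $[n]$ exactly once. For $\omega\in\{+,-\}$ the oriented expansion of a shell is $\operatorname{ord}_+(B_r)=(a-r,b+r)$, $\operatorname{ord}_-(B_r)=(b+r,a-r)$, with the duplicate entry removed when $B_0$ is a singleton. A shell traversal is a permutation $(r_0,\ldots,r_q)$ of $\{0,\ldots,q\}$. It satisfies the maximal-radial-contrast rule when $r_0=0$ and for each $1\le k\le q$, $r_k\in\operatorname{arg\,max}_{r\in\{0,\ldots,q\}\setminus\{r_0,\ldots,r_{k-1}\}}|r-r_{k-1}|$.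 There is exactly one such shell traversal, given by $r_0=0$ and, for $1\le k\le q$, $r_k=q-(k-1)/2$ for $k$ odd and $r_k=k/2$ for $k$ even. With this $(r_0,\ldots,r_q)$, $\operatorname{MEA}_{n,\omega}$ is defined as the concatenation $\operatorname{ord}_\omega(B_{r_0})\,\Vert\,\operatorname{ord}_\omega(B_{r_1})\,\Vert\cdots\Vert\,\operatorname{ord}_\omega(B_{r_q})$. *)

(* Defs.v *)
From mathcomp Require Import all_boot ssralg ssrint.
Set Implicit Arguments.
Unset Strict Implicit.
Unset Printing Implicit Defensive.

Definition center_lo (n : nat) : nat := n.+1 %/ 2.
Definition center_hi (n : nat) : nat := uphalf n.+1.
Definition max_radius (n : nat) : nat := n.-1 %/ 2.

(* For 1 <= n and r <= max_radius n the subtraction does not truncate. *)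
Definition shell (n r : nat) : pred nat :=
  [pred x | (x == center_lo n - r) || (x == center_hi n + r)].

Inductive orientation : Type := Plus | Minus.

(* [undup] only acts on the singleton shell, n odd and r = 0. *)
Definition oriented_shell (n : nat) (w : orientation) (r : nat) : seq nat :=
  undup match w with
        | Plus => [:: center_lo n - r; center_hi n + r]
        | Minus => [:: center_hi n + r; center_lo n - r]
        end.

(* The k = 0 case falls under the even formula. *)
Definition mea_radius (n k : nat) : nat :=
  if odd k then max_radius n - k.-1 %/ 2 else k %/ 2.

Definition MEA (n : nat) (w : orientation) : seq nat :=
  flatten [seq oriented_shell n w (mea_radius n k)
          | k <- iota 0 (max_radius n).+1].

Definition traversal (n : nat) (s : seq nat) : Prop := perm_eq s (iota 1 n).

Definition central_first (n : nat) (s : seq nat) : Prop :=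
  exists t u : seq nat, s = t ++ u /\ t =i shell n 0.

Definition shells_contiguous (n : nat) (s : seq nat) : Prop :=
  forall r, r <= max_radius n ->
  exists s1 t s2 : seq nat, s = s1 ++ t ++ s2 /\ t =i shell n r.

(* [rs] is the order in which the traversal [s] visits the shells.  When every
   shell is contiguous in [s], there is exactly one such [rs]. *)
Definition visit_order (n : nat) (s rs : seq nat) : Prop :=
  perm_eq rs (iota 0 (max_radius n).+1) /\
  forall i j, i < j <= max_radius n ->
  forall x y, x \in shell n (nth 0 rs i) -> y \in shell n (nth 0 rs j) ->
  index x s < index y s.

Definition is_argmax (A : pred nat) (f : nat -> nat) (r : nat) : Prop :=
  r \in A /\ forall r', r' \in A -> f r' <= f r.

Definition max_radial_contrast (n : nat) (s : seq nat) : Prop :=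
  forall rs, visit_order n s rs ->
  forall k, 1 <= k <= max_radius n ->
  is_argmax [pred r | (r <= max_radius n) && (r \notin take k rs)]
            (fun r => absz (r%:Z - (nth 0 rs k.-1)%:Z)%R)
            (nth 0 rs k).

Definition globally_oriented (n : nat) (w : orientation) (s : seq nat) : Prop :=
  forall r, r <= max_radius n -> center_lo n - r <> center_hi n + r ->
  subseq (oriented_shell n w r) s.

(* Main.v *)
Require Import Defs.
From mathcomp Require Import all_boot.
From mathcomp Require Import ssrint zify.
Set Implicit Arguments.
Unset Strict Implicit.
Unset Printing Implicit Defensive.

(** A traversal is recovered from two pieces of data: the order in which it
    visits the shells, and the order in which it lists the entries inside each
    shell.  Orientation fixes the second; the central start ([visit_order_head])
    and maximal radial contrast fix the first, so at most one traversal
    qualifies.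

    To make this precise, read a duplicate-free sequence [s] as the strict order
    [before s] on its entries; two permutations of each other are equal as soon
    as one of them is increasing for the order of the other
    ([eq_of_pairwise_before]).  Contiguity forces the order to compare any two
    distinct shells as wholes, so a visit order [rs] exists
    ([visit_order_exists]); it is unique, since it lists the radii by increasing
    position ([visit_order_unique]).  With the orientation this gives
    [s = expand n w rs] ([traversal_eq_expand]).

    The visit order itself is computed step by step.  After [k] steps of the
    alternation 0, q, 1, q - 1, ... with [q = max_radius n], the radii left form an interval, and the last
    radius engaged is adjacent to one end of it; hence the farthest radius is the
    other end, without ties, and it is the next term of the alternation
    ([argmax_mea_radius]).  The same lemma shows that the alternation obeys the
    contrast rule, which gives existence. *)

(** * Sequences as strict orders *)

Definition before (s : seq nat) : rel nat := fun x y => index x s < index y s.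

Lemma pairwise_before (s : seq nat) : uniq s -> pairwise (before s) s.
Proof.
move=> us; apply/(pairwiseP 0) => i j; rewrite !inE => li lj lij.
by rewrite /before !index_uniq.
Qed.

Lemma before_trans (s : seq nat) : transitive (before s).
Proof. by move=> y x z; apply: ltn_trans. Qed.

Lemma before_irr (s : seq nat) : irreflexive (before s).
Proof. by move=> x; apply: ltnn. Qed.

(** [s] is also increasing for its own order, and a set has only one increasing
    enumeration for a given strict order. *)
Lemma eq_of_pairwise_before (s u : seq nat) :
  uniq s -> s =i u -> pairwise (before s) u -> s = u.
Proof.
move=> us eq_su pu.
apply: (irr_sorted_eq (@before_trans s) (@before_irr s)) => //.
  by rewrite sorted_pairwise; [apply: pairwise_before | apply: before_trans].
by rewrite sorted_pairwise //; apply: before_trans.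
Qed.

Lemma pairwise_flatten (T : Type) (r : rel T) (ss : seq (seq T)) :
  pairwise r (flatten ss) = all (pairwise r) ss && pairwise (allrel r) ss.
Proof.
have allrel_flatten (t : seq T) us : allrel r t (flatten us) = all (allrel r t) us.
  elim: us => [|u us IH] /=; first exact: allrel0r.
  by rewrite allrel_catr IH.
elim: ss => //= t ss IH; rewrite pairwise_cat allrel_flatten IH.
by case: (all _ ss) (pairwise r t) (all _ ss) => [] [] [].
Qed.

(** The positions of a block form an interval, and without repetition an outside
    entry has its position below or above that whole interval. *)
Lemma block_before (s1 t s2 : seq nat) x x' y :
    let s := s1 ++ t ++ s2 in
    uniq s -> x \in t -> x' \in t -> y \notin t ->
  (before s x y = before s x' y) * (before s y x = before s y x').
Proof.
move=> s us xt x't yt; have := us.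
rewrite /s cat_uniq => /and3P[_ /hasPn ns1 _].
have side z : z \in t -> size s1 <= index z s < size s1 + size t.
  move=> zt; have /ns1/negbTE zs1 : z \in t ++ s2 by rewrite mem_cat zt.
  by rewrite /s !index_cat zs1 zt leq_addr ltn_add2l index_mem.
have out : (index y s < size s1) || (size s1 + size t <= index y s).
  rewrite /s !index_cat (negbTE yt); case: ifP => ys1; first by rewrite index_mem ys1.
  by apply/orP; right; rewrite leq_add2l leq_addr.
have := side x xt; have := side x' x't; rewrite /before -/s; split; lia.
Qed.

(** * Shells *)

Lemma mem_oriented_shell n w r : oriented_shell n w r =i shell n r.
Proof. by case: w => x; rewrite mem_undup !inE // orbC. Qed.

Lemma shell_lo n r : center_lo n - r \in shell n r.
Proof. by rewrite !inE eqxx. Qed.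

Lemma shell_disjoint n r r' x : 0 < n ->
    r <= max_radius n -> r' <= max_radius n ->
  x \in shell n r -> x \in shell n r' -> r = r'.
Proof. rewrite !inE /center_lo /center_hi /max_radius; lia. Qed.

Definition radius n x :=
  if x <= center_lo n then center_lo n - x else x - center_hi n.

Lemma shell_cover n x : 0 < n ->
  x \in iota 1 n -> (x \in shell n (radius n x)) && (radius n x <= max_radius n).
Proof.
by move=> n0; rewrite mem_iota !inE /radius /center_lo /center_hi /max_radius;
  case: ifP; lia.
Qed.

Lemma shell_range n r x : 0 < n -> r <= max_radius n ->
  x \in shell n r -> x \in iota 1 n.
Proof. rewrite mem_iota !inE /center_lo /center_hi /max_radius; lia. Qed.

(** * Traversals obtained by expanding a shell traversal *)

Definition expand n w (rs : seq nat) : seq nat :=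
  flatten [seq oriented_shell n w r | r <- rs].

Definition shell_traversal n (rs : seq nat) : Prop :=
  perm_eq rs (iota 0 (max_radius n).+1).

Section ShellTraversal.

Variables (n : nat) (w : orientation) (rs : seq nat).
Hypotheses (n_gt0 : 0 < n) (rsP : shell_traversal n rs).

Lemma mem_shell_traversal r : (r \in rs) = (r <= max_radius n).
Proof. by rewrite (perm_mem rsP) mem_iota ltnS. Qed.

Lemma size_shell_traversal : size rs = (max_radius n).+1.
Proof. by rewrite (perm_size rsP) size_iota. Qed.

Lemma uniq_shell_traversal : uniq rs.
Proof. by rewrite (perm_uniq rsP) iota_uniq. Qed.

Lemma nth_shell_traversal i : i <= max_radius n -> nth 0 rs i <= max_radius n.
Proof.
by move=> li; rewrite -mem_shell_traversal mem_nth // size_shell_traversal ltnS.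
Qed.

Lemma mem_expand : expand n w rs =i iota 1 n.
Proof.
move=> x; apply/flattenP/idP => [[_ /mapP[r rrs ->]]|].
  rewrite mem_oriented_shell => xr.
  by apply: shell_range xr; rewrite // -mem_shell_traversal.
move=> /(shell_cover n_gt0) /andP[xr lr].
exists (oriented_shell n w (radius n x)); last by rewrite mem_oriented_shell.
by rewrite map_f // mem_shell_traversal.
Qed.

Lemma uniq_expand : uniq (expand n w rs).
Proof.
rewrite uniq_pairwise pairwise_flatten; apply/andP; split.
  by apply/allP => _ /mapP[r _ ->]; rewrite -uniq_pairwise undup_uniq.
rewrite pairwise_map; have := uniq_shell_traversal; rewrite uniq_pairwise.
apply: (sub_in_pairwise (P := mem rs)); last exact/allP.
move=> r r' rrs r'rs /= neq_r; apply/allrelP => x y.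
rewrite !mem_oriented_shell => xr yr'; apply: contraNneq neq_r => eq_xy.
by rewrite (@shell_disjoint n r r' x) -?mem_shell_traversal // eq_xy.
Qed.

Lemma traversal_expand : traversal n (expand n w rs).
Proof. by apply: uniq_perm (iota_uniq _ _) mem_expand; apply: uniq_expand. Qed.

Lemma expand_split r : r <= max_radius n ->
  exists s1 s2, expand n w rs = s1 ++ oriented_shell n w r ++ s2.
Proof.
rewrite -mem_shell_traversal /expand => /splitPr[p1 p2].
rewrite map_cat flatten_cat /=.
by exists (flatten (map (oriented_shell n w) p1)),
          (flatten (map (oriented_shell n w) p2)).
Qed.

Lemma contiguous_expand : shells_contiguous n (expand n w rs).
Proof.
move=> r /expand_split[s1 [s2 ->]]; exists s1, (oriented_shell n w r), s2.
by split=> //; apply: mem_oriented_shell.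
Qed.

Lemma oriented_expand : globally_oriented n w (expand n w rs).
Proof.
move=> r /expand_split[s1 [s2 ->]] _.
exact: subseq_trans (prefix_subseq _ _) (suffix_subseq _ _).
Qed.

Lemma visit_order_expand : visit_order n (expand n w rs) rs.
Proof.
split=> // i j /andP[lij lj] x y xi yj.
have := pairwise_before uniq_expand; rewrite pairwise_flatten pairwise_map.
case/andP=> _ /(pairwiseP 0)/(_ i j); rewrite !inE size_shell_traversal !ltnS.
move=> /(_ (leq_trans (ltnW lij) lj) lj lij) /allrelP; apply;
  by rewrite mem_oriented_shell.
Qed.

End ShellTraversal.

(** * Traversals with contiguous shells *)

Section VisitOrder.

Variables (n : nat) (s : seq nat).
Hypotheses (n_gt0 : 0 < n) (sP : traversal n s).

Let us : uniq s. Proof. by rewrite (perm_uniq sP) iota_uniq. Qed.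

Definition shell_before : rel nat :=
  fun r r' => before s (center_lo n - r) (center_lo n - r').

(** A visit order lists the radii by increasing position of the lower endpoints
    [center_lo n - r], and a set has only one increasing enumeration. *)
Lemma visit_order_unique rs rs' :
  visit_order n s rs -> visit_order n s rs' -> rs = rs'.
Proof.
have tr : transitive shell_before by move=> ? ? ?; apply: ltn_trans.
have srt rs0 : visit_order n s rs0 -> sorted shell_before rs0.
  move=> [rs0P vo]; rewrite sorted_pairwise //; apply/(pairwiseP 0) => i j.
  rewrite !inE (size_shell_traversal rs0P) !ltnS => li lj lij.
  by apply: (vo i j); rewrite ?lij ?shell_lo.
move=> vrs vrs'; apply: (irr_sorted_eq tr) => //; [|exact: srt|exact: srt|].
  by move=> r; apply: ltnn.
by move=> r; case: vrs vrs' => rsP _ [rsP' _]; rewrite (perm_mem rsP) (perm_mem rsP').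
Qed.

(** The radii are sorted by the position of their lower endpoints; by
    contiguity, any other choice of representatives compares two distinct shells
    in the same way. *)
Lemma visit_order_exists : shells_contiguous n s -> exists rs, visit_order n s rs.
Proof.
move=> ctg.
pose le r r' := index (center_lo n - r) s <= index (center_lo n - r') s.
have le_total : total le by move=> r r'; apply: leq_total.
have le_trans : transitive le by move=> ? ? ?; apply: leq_trans.
pose rs := sort le (iota 0 (max_radius n).+1).
have rsP : shell_traversal n rs by rewrite /shell_traversal perm_sort.
exists rs; split=> // i j /andP[lij lj] x y xi yj.
have li := leq_trans (ltnW lij) lj.
have [ri rj] := (nth_shell_traversal rsP li, nth_shell_traversal rsP lj).
have sz := size_shell_traversal rsP.
have neq : nth 0 rs i != nth 0 rs j.
  by rewrite nth_uniq ?sz ?ltnS ?(uniq_shell_traversal rsP) // neq_ltn lij.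
have leij : le (nth 0 rs i) (nth 0 rs j).
  have le_refl : reflexive le by move=> r; apply: leqnn.
  have srt : sorted le rs by apply: sort_sorted.
  by apply: (sorted_leq_nth le_trans le_refl 0 srt);
    rewrite ?inE ?sz ?ltnS ?(ltnW lij).
move: {leij lij} (nth 0 rs i) (nth 0 rs j) ri rj xi yj neq leij
  => r r' lr lr' xr yr' neq le_rr'.
have not_shell z r1 r2 : r1 <= max_radius n -> r2 <= max_radius n -> r1 != r2 ->
    z \in shell n r2 -> z \notin shell n r1.
  move=> l1 l2 n12 z2; apply: contra n12 => z1.
  by rewrite (shell_disjoint n_gt0 l1 l2 z1 z2).
(* Contiguity lets each entry be replaced by the lower endpoint of its shell. *)
have swap1 z : z \in shell n r' -> before s x z = before s (center_lo n - r) z.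
  move=> zr'; have [s1 [t [s2 [es et]]]] := ctg r lr; move: us; rewrite es => us0.
  rewrite (block_before (x' := center_lo n - r) us0) ?et ?shell_lo //.
  exact: not_shell zr'.
have swap2 : before s (center_lo n - r) y
           = before s (center_lo n - r) (center_lo n - r').
  have [s1 [t [s2 [es et]]]] := ctg r' lr'; move: us; rewrite es => us0.
  rewrite (block_before (x := y) (x' := center_lo n - r')
    (y := center_lo n - r) us0) ?et ?shell_lo //.
  by apply: (@not_shell _ r' r); rewrite ?shell_lo // eq_sym.
have mem_lo r1 : r1 <= max_radius n -> center_lo n - r1 \in s.
  by move=> l1; rewrite (perm_mem sP); apply: shell_range (shell_lo n r1).
have neq_lo : center_lo n - r != center_lo n - r'.
  apply: contra neq => /eqP eq_lo; apply/eqP.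
  by apply: (shell_disjoint n_gt0 lr lr' (shell_lo n r)); rewrite eq_lo shell_lo.
rewrite -/(before s x y) swap1 // swap2 /before ltn_neqAle -/(le r r') le_rr'.
rewrite andbT; apply: contra neq_lo => /eqP eq_index; apply/eqP.
by apply: (index_inj 0) eq_index; apply: mem_lo.
Qed.

(** The expansion of [rs] is increasing for the order of [s]: between shells by
    the visit order, and inside a shell by the orientation. *)
Lemma traversal_eq_expand w rs :
  visit_order n s rs -> globally_oriented n w s -> s = expand n w rs.
Proof.
move=> [rsP vo] ow; apply: eq_of_pairwise_before => //.
  by move=> x; rewrite mem_expand // (perm_mem sP).
rewrite pairwise_flatten; apply/andP; split.
  apply/allP => _ /mapP[r rrs ->].
  have lr : r <= max_radius n by rewrite -(mem_shell_traversal rsP).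
  case: (eqVneq (center_lo n - r) (center_hi n + r)) => [eq_r|/eqP neq_r].
    by case: w {ow}; rewrite /oriented_shell eq_r /= inE eqxx.
  by apply: subseq_pairwise (ow r lr neq_r) _; apply: pairwise_before.
rewrite pairwise_map; apply/(pairwiseP 0) => i j.
rewrite !inE (size_shell_traversal rsP) !ltnS => li lj lij.
apply/allrelP => x y; rewrite !mem_oriented_shell; apply: vo; exact/andP.
Qed.

(** The prefix that fills the central block would otherwise contain an entry
    preceded by the whole first shell, which lies outside that prefix. *)
Lemma visit_order_head rs :
  central_first n s -> visit_order n s rs -> nth 0 rs 0 = 0.
Proof.
move=> [t [u [es et]]] [rsP vo]; apply/eqP/negPn/negP => nz.
have : 0 \in rs by rewrite (mem_shell_traversal rsP).
case/(nthP 0) => j; rewrite (size_shell_traversal rsP) ltnS => lj e0.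
have j0 : 0 < j by case: j {lj} e0 nz => // ->.
have := vo 0 j; rewrite j0 lj => /(_ isT) /(_ _ _ (shell_lo _ _) (shell_lo _ _)).
rewrite e0 es !index_cat !et shell_lo ifN.
  have : index (center_lo n - 0) t < size t by rewrite index_mem et shell_lo.
  by move=> lt_t /ltn_trans/(_ lt_t); rewrite ltnNge leq_addr.
apply: contra nz => c0; apply/eqP.
by apply: (shell_disjoint n_gt0 _ _ (shell_lo n _) c0) => //;
  apply: nth_shell_traversal.
Qed.

End VisitOrder.

(** * The maximal-radial-contrast rule *)

(** The radii of even rank climb from 0 and those of odd rank descend from
    [max_radius n]; among the first [k] ranks, [uphalf k] are even and [k./2] are
    odd. *)
Lemma notin_mea_radius n k r : k <= (max_radius n).+1 -> r <= max_radius n ->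
  (r \notin mkseq (mea_radius n) k) = (uphalf k <= r <= max_radius n - k./2).
Proof.
elim: k => [|k IH] lk lr; first by rewrite /= subn0.
rewrite mkseqS mem_rcons inE negb_or IH ?(ltnW lk) // /mea_radius.
move: lk lr; case: ifP; lia.
Qed.

(** After [max_radius n + 1] steps the interval of remaining radii is empty, so
    the alternation covers all radii; by its length it has no repetition. *)
Lemma mea_shell_traversal n :
  shell_traversal n (mkseq (mea_radius n) (max_radius n).+1).
Proof.
rewrite /shell_traversal; set rs := mkseq _ _; set radii := iota 0 _.
have radii_sub : {subset radii <= rs}.
  move=> r; rewrite mem_iota ltnS => lr; apply/negPn.
  by rewrite notin_mea_radius //; move: lr; lia.
have le_size : size rs <= size radii by rewrite size_mkseq size_iota.
have radii_uniq : uniq radii by apply: iota_uniq.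
have [_ eq_rs] := uniq_min_size radii_uniq radii_sub le_size.
by apply: uniq_perm => //; exact: leq_size_uniq radii_uniq radii_sub le_size.
Qed.

(** The admissible radii are those between [uphalf k] and [max_radius n - k./2],
    and the radius [mea_radius n k.-1] lies just below this interval when [k] is
    odd and just above it when [k] is even, so the farthest one is the opposite
    end. *)
Lemma argmax_mea_radius n k r : 0 < k <= max_radius n ->
  is_argmax
    [pred r' | (r' <= max_radius n) && (r' \notin mkseq (mea_radius n) k)]
    (fun r' => absz (r'%:Z - (mea_radius n k.-1)%:Z)%R) r
  <-> r = mea_radius n k.
Proof.
move=> /andP[k0 kq].
have memE r' : (r' \in [pred r' | (r' <= max_radius n)
                                  && (r' \notin mkseq (mea_radius n) k)])
    = (uphalf k <= r' <= max_radius n - k./2).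
  rewrite inE; case: (leqP r' (max_radius n)) => lr' /=.
    by rewrite notin_mea_radius // ltnW.
  by lia.
split=> [[]|->].
  rewrite memE => rA /(_ (mea_radius n k)); rewrite memE; move: rA.
  rewrite /mea_radius; case: ifP; case: ifP; lia.
split=> [|r']; rewrite memE /mea_radius; case: ifP; try case: ifP; lia.
Qed.

(** The argmax being unique at each step, the whole sequence is determined by
    its first term. *)
Lemma contrast_eq_mea n rs : shell_traversal n rs -> nth 0 rs 0 = 0 ->
  (forall k, 1 <= k <= max_radius n ->
    is_argmax [pred r | (r <= max_radius n) && (r \notin take k rs)]
      (fun r => absz (r%:Z - (nth 0 rs k.-1)%:Z)%R) (nth 0 rs k)) ->
  rs = mkseq (mea_radius n) (max_radius n).+1.
Proof.
move=> rsP rs0 mx; have sz := size_shell_traversal rsP.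
suff pfx k : k <= (max_radius n).+1 -> take k rs = mkseq (mea_radius n) k.
  by rewrite -(pfx (max_radius n).+1) // -sz take_size.
elim: k => [|k IH] lk; first by rewrite take0.
have tk := IH (ltnW lk).
rewrite (take_nth 0) ?sz // mkseqS tk; congr rcons.
case: k lk tk {IH} => [|k] lk tk; first by rewrite rs0.
have prev : nth 0 rs k = mea_radius n k.
  by rewrite -(@nth_take k.+1) // tk nth_mkseq.
have := mx k.+1 lk; rewrite tk /= prev => mxk.
by apply/(argmax_mea_radius (k := k.+1)).
Qed.

Lemma MEA_expand n w :
  MEA n w = expand n w (mkseq (mea_radius n) (max_radius n).+1).
Proof. by rewrite /expand /mkseq -map_comp. Qed.

Theorem corollary4p3 (n : nat) (w : orientation) (hn : 1 <= n) :
  unique (fun s : seq nat =>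
            [/\ traversal n s,
                central_first n s,
                shells_contiguous n s,
                max_radial_contrast n s
              & globally_oriented n w s])
         (MEA n w).
Proof.
have mP := mea_shell_traversal n.
split=> [|s [sT s0 sC sM sO]]; rewrite MEA_expand; last first.
  have [rs vo] := visit_order_exists hn sT sC.
  rewrite (traversal_eq_expand hn sT vo sO); congr expand.
  apply/esym; apply: contrast_eq_mea; first by case: vo.
    exact: visit_order_head vo.
  exact: sM vo.
split.
- exact: traversal_expand.
- exists (oriented_shell n w (mea_radius n 0)).
  eexists; split; last exact: mem_oriented_shell.
  by [].
- exact: contiguous_expand.
- move=> rs vo k kq; have /andP[_ lk] := kq.
  have -> : rs = mkseq (mea_radius n) (max_radius n).+1.
    apply: visit_order_unique vo (visit_order_expand w hn mP).
  have -> : take k (mkseq (mea_radius n) (max_radius n).+1)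
          = mkseq (mea_radius n) k.
    by rewrite /mkseq -map_take take_iota (minn_idPl _) // ltnW.
  rewrite !nth_mkseq ?ltnS //; last by rewrite (leq_trans (leq_pred k)).
  exact/argmax_mea_radius.
- exact: oriented_expand.
Qed.
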